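(* Let $A\geq a\geq 1$ and $r\geq 2$ be integers. Then \[ \sum_{\pi\in\overline{\mathcal{P}}}z^{\overline{mes}_{r,A,a}(\pi)}q^{|\pi|} =\frac{(-q;q)_{\infty}}{(q;q)_{\infty}}\sum_{k=0}^{\infty}z^{kA+a}\bigg[\frac{q^{r[A\binom{k}{2}+ka]}}{(-q^a;q^A)_k}-\frac{q^{r[A\binom{k+1}{2}+(k+1)a]}}{(-q^a;q^A)_{k+1}}\bigg]. \]
   Context: An overpartition is a partition (finite non-increasing sequence of positive integers) in which the first occurrence of each part value may be overlined; $\overline{\mathcal{P}}$ is the set of all overpartitions and $|\pi|$ the sum of parts. A part is of size $t$ if it equals $t$ or $\overline{t}$. $(a;q)_\infty=\prod_{i\geq0}(1-aq^i)$, $(a;q)_n=(a;q)_\infty/(aq^n;q)_\infty$; $|q|<1$, $z$ a formal variable. For $r\geq2$, $\overline{mes}_{r,A,a}(\pi)$ is the smallest positive integer $m\equiv a\pmod A$ such that either $\pi$ has no overlined part $\overline{m}$ or $\pi$ has fewer than $r-1$ non-overlined parts equal to $m$. *)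

(* Defs.v *)
From HB Require Import structures.
From mathcomp Require Import all_boot all_order all_algebra finmap.
From mathcomp Require Export complex.
From mathcomp Require Import boolp classical_sets reals topology normedtype.
From mathcomp Require Import sequences.
From mathcomp Require summability.

Set Implicit Arguments.
Unset Strict Implicit.
Unset Printing Implicit Defensive.
Import Order.TTheory GRing.Theory Num.Theory numFieldNormedType.Exports.

Local Open Scope classical_set_scope.
Local Open Scope ring_scope.

(* A part is a pair (size, flag), with flag = true for an overlined part.     *)
(* The last conjunct allows an overline only on the first occurrence of a     *)
(* size in the sequence.                                                      *)
Definition is_overpartition (s : seq (nat * bool)) : bool :=
  [&& sorted geq (unzip1 s),
      all (fun t => 0 < t)%N (unzip1 s) &
      [forall i : 'I_(size s),
         (nth (0%N, false) s i).2 ==>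
         ((nth (0%N, false) s i).1 \notin unzip1 (take i s))]].

Record overpartition := Overpartition {
  oparts :> seq (nat * bool);
  _ : is_overpartition oparts }.

HB.instance Definition _ := [isSub for oparts].
HB.instance Definition _ := [Countable of overpartition by <:].

Definition weight (p : overpartition) : nat := sumn (unzip1 p).

Definition mes_cond (r A a : nat) (p : overpartition) (m : nat) : bool :=
  [&& (0 < m)%N, m == a %[mod A] &
      ((m, true) \notin (p : seq _)) ||
      (count_mem (m, false) (p : seq _) < r - 1)%N].

Lemma mes_cond_ex (r A a : nat) (A_gt0 : (0 < A)%N) (p : overpartition) :
  exists m, mes_cond r A a p m.
Proof.
have in_le (s : seq (nat * bool)) x : x \in s -> (x.1 <= sumn (unzip1 s))%N.
  elim: s => //= y s IH; rewrite inE => /predU1P[->|/IH]; first exact: leq_addr.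
  by move=> h; apply: leq_trans h (leq_addl _ _).
have ltm : (weight p < (weight p).+1 * A + a)%N.
  by apply: leq_trans (leq_addr _ _); rewrite -{1}[(weight p).+1]muln1 leq_mul2l A_gt0 orbT.
exists ((weight p).+1 * A + a)%N; apply/and3P; split.
- exact: leq_ltn_trans ltm.
- by rewrite modnMDl.
- apply/orP; left; apply/negP => /in_le /=; rewrite leqNgt.
  by rewrite -/(weight p) ltm.
Qed.

(* For A = 0 there may be no such m, hence the argument A_gt0.                *)
Definition mes (r A a : nat) (A_gt0 : (0 < A)%N) (p : overpartition) : nat :=
  ex_minn (mes_cond_ex r a A_gt0 p).

Definition qpoch_inf (K : numFieldType) (x q : K) : K :=
  lim ((fun n : nat => \prod_(0 <= i < n) (1 - x * q ^+ i)) @ \oo).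

Definition qpoch (K : numFieldType) (x q : K) (n : nat) : K :=
  qpoch_inf x q / qpoch_inf (x * q ^+ n) q.

(* Formal power series in z, given by their coefficients. Infinite sums of    *)
(* them are taken in the product topology, i.e., coefficient by coefficient.  *)
Definition fps (K : numFieldType) := nat -> K.

(* c * z ^ n *)
Definition fps_mono (K : numFieldType) (c : K) (n : nat) : fps K :=
  fun m => if m == n then c else 0.

Definition fps_scale (K : numFieldType) (c : K) (f : fps K) : fps K :=
  fun m => c * f m.

(* Unordered sums: limits over the finite subsets of I ordered by inclusion.  *)
Definition fps_summable (K : numFieldType) (I : choiceType)
    (f : I -> fps K) : Prop :=
  forall m, cvg (summability.partial_sum (fun i => f i m : K)
                   @ summability.totally).

Definition fps_sum (K : numFieldType) (I : choiceType) (f : I -> fps K) :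
    fps K :=
  fun m => lim (summability.partial_sum (fun i => f i m : K)
                  @ summability.totally).

Definition fps_cvg_series (K : numFieldType) (f : nat -> fps K) : Prop :=
  forall m, cvg (series (fun k => f k m : K) @ \oo).

Definition fps_series (K : numFieldType) (f : nat -> fps K) : fps K :=
  fun m => lim (series (fun k => f k m : K) @ \oo).

(* Main.v *)
(** Writing [m_j = jA + a], the statistic is at least [m_k] exactly when, for
    every [j < k], the part [m_j] occurs overlined and at least [r - 1] times
    non-overlined. Each size [m] contributes the independent factor
    [(1 + q^m) / (1 - q^m)] to the generating function of all overpartitions,
    and this condition replaces it by [q^(rm) / (1 - q^m)] for [m = m_0, ...,
    m_(k-1)]. So the overpartitions with statistic at least [m_k] have
    generating function [(-q;q)_oo / (q;q)_oo] times
    [prod_(j < k) q^(r m_j) / (1 + q^(m_j))], and the coefficient of [z^(m_k)]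
    is the difference of two consecutive ones.

    Analytically, bounding the sizes by [N] and the multiplicities by [M] gives
    finite products of geometric sums, whose iterated limit ([M], then [N]) is a
    cluster point of the net of finite partial sums; absolute convergence makes
    the net Cauchy, hence convergent to it. *)

Require Import Defs.
From mathcomp Require Import all_boot all_order all_algebra finmap.
From mathcomp Require Import boolp classical_sets reals topology normedtype.
From mathcomp Require Import sequences exp.
From mathcomp Require summability.
From mathcomp Require Import ring lra zify.

Set Implicit Arguments.
Unset Strict Implicit.
Unset Printing Implicit Defensive.
Import Order.TTheory GRing.Theory Num.Theory numFieldNormedType.Exports.

Local Open Scope classical_set_scope.
Local Open Scope ring_scope.
Local Open Scope complex_scope.

(** * Infinite products and sums in [R[i]] *)

Lemma eq_fun_cvg (K : topologicalType) T (F : set_system T) (f g : T -> K)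
    (l : K) :
  f =1 g -> f @ F --> l -> g @ F --> l.
Proof. by move=> /funext ->. Qed.

(** If the limit of [f] were 0, the products [f n * g n] would tend to 0 as well as to 1. *)
Lemma lim_neq0 (K : numFieldType) (f g : nat -> K) :
  cvgn f -> cvgn g -> (forall n, f n * g n = 1) -> limn f != 0.
Proof.
move=> cf cg fg; apply/eqP => f0.
have h : (f \* g) @ \oo --> limn f * limn g by exact: cvgM.
rewrite f0 mul0r in h.
have /(cvg_unique (@norm_hausdorff _ _) (cvg_cst _)) := eq_fun_cvg fg h.
by apply/eqP; rewrite oner_neq0.
Qed.

Section ComplexLimits.
Variable R : realType.
Implicit Types (x y q : R[i]).

Lemma gt0_complexE (e : R[i]) : 0 < e -> exists2 d : R, 0 < d & e = d%:C.
Proof.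
case: e => d i; rewrite ltcE /= => /andP[/eqP -> d0].
by exists d.
Qed.

Lemma norm_complexE x : `|x| = (Normc.normc x)%:C.
Proof. by []. Qed.

(** The bound [|x + iy| <= |x| + |y|] reduces a complex limit to two real ones. *)
Lemma cvg_complex T (F : set_system T) {FF : Filter F} (f : T -> R[i])
    (l : R[i]) :
  (fun t => complex.Re (f t)) @ F --> complex.Re l ->
  (fun t => complex.Im (f t)) @ F --> complex.Im l ->
  (f : T -> (R[i] : numFieldType)) @ F --> (l : (R[i] : numFieldType)).
Proof.
move=> /cvgrPdist_lt cr /cvgrPdist_lt ci.
apply/cvgrPdist_lt => _ /gt0_complexE[e e0 ->].
have e20 : 0 < e / 2 by rewrite divr_gt0.
near=> t.
have hr : `|complex.Re l - complex.Re (f t)| < e / 2 by near: t; exact: cr.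
have hi : `|complex.Im l - complex.Im (f t)| < e / 2 by near: t; exact: ci.
rewrite [l - f t]complexE.
apply: le_lt_trans (ler_normD _ _) _.
rewrite normrM.
have -> : `|'i%C : R[i]| = 1 by rewrite norm_complexE /= expr0n add0r expr1n sqrtr1.
rewrite mul1r !normc_def /= expr0n /= !addr0 !sqrtr_sqr -rmorphD ltcR.
rewrite [ltRHS]splitr.
move: hr hi; case: (l) => lr li; case: (f t) => ur ui /= hr hi.
exact: ltrD.
Unshelve. all: by end_near.
Qed.


Lemma le_normr_complex (x : R[i]) (d : R) :
  `|x| <= d%:C -> `|complex.Re x| <= d /\ `|complex.Im x| <= d.
Proof.
rewrite normc_def lecR => h; split; apply: le_trans h;
  by rewrite -sqrtr_sqr ler_wsqrtr // ?lerDl ?lerDr sqr_ge0.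
Qed.

(** Real and imaginary parts are both dominated by [v], so they converge absolutely as real series;
    their limits make up the complex one. *)
Lemma is_cvg_series_complex (u : nat -> R[i]) (v : nat -> R) :
  (forall n, `|u n| <= (v n)%:C) -> cvgn (series v) ->
  cvgn (series (u : nat -> (R[i] : numFieldType))).
Proof.
move=> uv cv.
have main (w : nat -> R) : (forall n, `|w n| <= v n) -> cvgn (series w).
  move=> wv; apply: normed_cvg; apply: series_le_cvg cv => //= n.
  exact: le_trans (normr_ge0 _) (wv n).
have [/main cr /main ci] : (forall n, `|complex.Re (u n)| <= v n) /\
    (forall n, `|complex.Im (u n)| <= v n).
  by split=> n; case: (le_normr_complex (uv n)).
apply/cvg_ex; exists (Complex (limn (series (fun n => complex.Re (u n))))
  (limn (series (fun n => complex.Im (u n))))).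
apply: cvg_complex => /=.
- have -> : (fun t => complex.Re (series u t)) =
      series (fun n => complex.Re (u n)).
    apply/funext => n; rewrite /series /=.
    by apply: (big_morph (@complex.Re R)) => // -[? ?] [? ?].
  exact: cr.
- have -> : (fun t => complex.Im (series u t)) =
      series (fun n => complex.Im (u n)).
    apply/funext => n; rewrite /series /=.
    by apply: (big_morph (@complex.Im R)) => // -[? ?] [? ?].
  exact: ci.
Qed.

(** * Convergence and non-vanishing of infinite products *)

Lemma geometric_sum_le (t : R) n : 0 <= t < 1 ->
  \sum_(0 <= i < n) t ^+ i <= (1 - t)^-1.
Proof.
case/andP=> t0 t1; have t1' : 0 < 1 - t by rewrite subr_gt0.
rewrite -[leRHS]mul1r ler_pdivlMr // mulrC -[leLHS]opprK -mulNr opprB.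
rewrite big_mkord -subrX1 opprB lerBlDr lerDl exprn_ge0 //.
Qed.

Lemma prod_geometric_le (c t : R) n : 0 <= c -> 0 <= t < 1 ->
  \prod_(0 <= i < n) (1 + c * t ^+ i) <= expR (c / (1 - t)).
Proof.
move=> c0 t01; have t0 : 0 <= t by case/andP: t01.
apply: (@le_trans _ _ (expR (c * \sum_(0 <= i < n) t ^+ i))); last first.
  by rewrite ler_expR ler_wpM2l // geometric_sum_le.
elim: n => [|n IH]; first by rewrite !big_nil mulr0 expR0.
rewrite !big_nat_recr //= [c * (_ + _)]mulrDr expRD ler_pM ?expR_ge1Dx //.
- by apply: prodr_ge0 => i _; rewrite addr_ge0 // mulr_ge0 // exprn_ge0.
- by rewrite addr_ge0 // mulr_ge0 // exprn_ge0.
Qed.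

(** Since [P n.+1 - P n = P n * u n], the products are, up to the constant 1, partial sums of a
    series. Bounding [P] through [1 + x <= exp x] makes its terms geometrically dominated. *)
Lemma is_cvg_prod1D (u : nat -> R[i]) (c t : R) : 0 <= c -> 0 <= t < 1 ->
  (forall n, `|u n| <= (c * t ^+ n)%:C) ->
  cvgn (fun n => \prod_(0 <= i < n) (1 + u i) : (R[i] : numFieldType)).
Proof.
move=> c0 t01 uct; have [t0 t1] := andP t01.
pose P n := \prod_(0 <= i < n) (1 + u i).
have PE n : P n = 1 + series (fun i => P i * u i : (R[i] : numFieldType)) n.
  elim: n => [|n IH]; first by rewrite /P /series /= !big_nil addr0.
  rewrite /P /series /= !big_nat_recr //= -/(P n) mulrDr mulr1 {1}IH.
  by rewrite addrA.
have Pb n : `|P n| <= (expR (c / (1 - t)))%:C.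
  apply: (@le_trans _ _ (\prod_(0 <= i < n) (1 + c * t ^+ i))%:C); last first.
    by rewrite lecR prod_geometric_le.
  rewrite normr_prod rmorph_prod; apply: ler_prod => i _.
  rewrite normr_ge0 /=; apply: le_trans (ler_normD _ _) _.
  by rewrite normr1 rmorphD lerD2l.
have -> : (fun n => \prod_(0 <= i < n) (1 + u i) : (R[i] : numFieldType)) =
    (fun n => 1 + series (fun i => P i * u i : (R[i] : numFieldType)) n).
  by apply/funext => n; rewrite -PE.
apply: is_cvgD; first exact: is_cvg_cst.
apply: (@is_cvg_series_complex _ (fun n => expR (c / (1 - t)) * c * t ^+ n)).
  move=> n; rewrite normrM -mulrA rmorphM.
  by apply: ler_pM => //; exact: normr_ge0.
apply: is_cvg_geometric_series.
by rewrite ger0_norm.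
Qed.

Lemma norm_lt1_complexE x : `|x| < 1 ->
  exists2 t : R, 0 <= t < 1 & `|x| = t%:C.
Proof.
rewrite norm_complexE => x1; exists (Normc.normc x) => //.
by rewrite -lecR -ltcR x1 -norm_complexE normr_ge0.
Qed.

Lemma is_cvg_qpoch_inf x q : `|q| < 1 ->
  cvgn (fun n => \prod_(0 <= i < n) (1 - x * q ^+ i) : (R[i] : numFieldType)).
Proof.
move=> /norm_lt1_complexE[t t01 qt].
apply: (@is_cvg_prod1D (fun i => - (x * q ^+ i)) (Normc.normc x) t) => //.
  by rewrite -lecR -norm_complexE normr_ge0.
by move=> n; rewrite normrN normrM normrX qt rmorphM rmorphXn.
Qed.

(* The partial products of the inverses [1 + y / (1 - y)] converge as well. *)
Lemma qpoch_inf_neq0 x q : `|x| < 1 -> `|q| < 1 -> qpoch_inf x q != 0.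
Proof.
move=> x1 q1; have cP := is_cvg_qpoch_inf (x := x) q1.
have [t t01 qt] := norm_lt1_complexE q1.
have [s s01 xs] := norm_lt1_complexE x1.
have [t0 t1] := andP t01; have [s0 s1] := andP s01.
have s1' : 0 < 1 - s by rewrite subr_gt0.
(* This bound, uniform in [n], keeps [x * q ^+ n / (1 - x * q ^+ n)] below [s / (1 - s) * t ^+ n] in
   norm. *)
have lb n : (1 - s)%:C <= `|1 - x * q ^+ n|.
  apply: le_trans (lerB_dist _ _); rewrite normr1 normrM normrX xs qt.
  rewrite rmorphB rmorph1 lerD2l lerN2 -rmorphXn -rmorphM lecR.
  by rewrite ler_piMr // exprn_ile1 // ltW.
have nz n : 1 - x * q ^+ n != 0.
  by rewrite -normr_gt0; apply: lt_le_trans (lb n); rewrite (ltcR 0).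
have cQ : cvgn (fun n => \prod_(0 <= i < n) (1 - x * q ^+ i)^-1
    : (R[i] : numFieldType)).
  have -> : (fun n => \prod_(0 <= i < n) (1 - x * q ^+ i)^-1) =
      (fun n => \prod_(0 <= i < n) (1 + x * q ^+ i / (1 - x * q ^+ i))).
    apply/funext => n; apply: eq_bigr => i _.
    by rewrite -{1}[(1 - _)^-1]mul1r -{1}[1](subrK (x * q ^+ i)) mulrDl divff.
  apply: (@is_cvg_prod1D _ (s / (1 - s)) t) => //.
    by rewrite divr_ge0 // ltW.
  move=> n; rewrite normrM normfV normrM normrX xs qt mulrAC.
  rewrite 2!rmorphM rmorphXn fmorphV ler_wpM2r //.
    by rewrite -rmorphXn (lecR 0) exprn_ge0.
  rewrite ler_wpM2l ?(lecR 0) // lef_pV2 ?posrE ?normr_gt0 ?(ltcR 0) //; exact: lb.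
apply: lim_neq0 cP cQ _ => n; rewrite -big_split /=.
by apply: big1 => i _; rewrite divff.
Qed.

End ComplexLimits.

(** * Unordered sums and geometric series *)

Section ComplexSums.
Variable R : realType.
Implicit Types (x y q : R[i]).

Lemma sum_fset_sub (V : zmodType) (I : choiceType) (f : I -> V)
    (S T : {fset I}) : (S `<=` T)%fset ->
  \sum_(i <- T) f i - \sum_(i <- S) f i = \sum_(i <- (T `\` S)%fset) f i.
Proof.
move=> ST; rewrite (big_fsetID _ (mem S)) /=.
have -> : [fset x in T | x \in S]%fset = S.
  by apply/fsetP => i; rewrite !inE /= andb_idl // => /(fsubsetP ST).
have -> : [fset x in T | x \notin S]%fset = (T `\` S)%fset.
  by apply/fsetP => i; rewrite !inE /= andbC.
by rewrite addrAC subrr add0r.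
Qed.

(* A dominated net of partial sums is Cauchy, so a cluster point is its limit. *)
Lemma cvg_totally_cluster (I : choiceType) (f : I -> R[i]) (g : I -> R)
    (B : R) (L : R[i]) :
  (forall i, `|f i| <= (g i)%:C) ->
  (forall S : {fset I}, \sum_(i <- S) g i <= B) ->
  (forall (S : {fset I}) (e : R), 0 < e -> exists2 T : {fset I},
     (S `<=` T)%fset & `|L - \sum_(i <- T) f i| < e%:C) ->
  summability.partial_sum (fun i => f i : (R[i] : numFieldType))
    @ summability.totally --> (L : (R[i] : numFieldType)).
Proof.
move=> fg gB fL.
have FF : Filter (@summability.totally I) by exact: summability.totally_filter.
apply/cvgrPdist_lt => _ /gt0_complexE[e e0 ->].
have e30 : 0 < e / 3 by rewrite divr_gt0.
pose E := [set \sum_(i <- S) g i | S in [set: {fset I}]].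
have supE : has_sup E.
  split; first by exists (\sum_(i <- fset0) g i); exists fset0.
  by exists B => _ [S _ <-].
(* A finite [S] whose sum of [g] is within [e / 3] of the supremum leaves less than [e / 3] to any
   finite set disjoint from it. *)
have [_ [S _ <-] supS] := sup_adherent e30 supE.
have tail (T : {fset I}) : (S `<=` T)%fset ->
    `|\sum_(i <- T) f i - \sum_(i <- S) f i| < (e / 3)%:C.
  move=> ST; rewrite sum_fset_sub //.
  apply: le_lt_trans (ler_norm_sum _ _ _) _.
  apply: (@le_lt_trans _ _ (\sum_(i <- (T `\` S)%fset) g i)%:C).
    by rewrite rmorph_sum; apply: ler_sum.
  rewrite ltcR -sum_fset_sub // ltrBlDl -ltrBlDr.
  by apply: le_lt_trans supS; rewrite lerD2r; apply: sup_upper_bound => //; exists T.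
have [T ST LT] := fL S _ e30.
exists S => // U /= SU; rewrite /summability.partial_sum.
have -> : \sum_(i : U) f (val i) = \sum_(i <- U) f i by rewrite big_seq_fsetE.
(* [T] is close to [L], and both [T] and [U] contain [S], so each differs from [S] by less than
   [e / 3]. *)
have -> : L - \sum_(i <- U) f i = (L - \sum_(i <- T) f i) +
  ((\sum_(i <- T) f i - \sum_(i <- S) f i) -
   (\sum_(i <- U) f i - \sum_(i <- S) f i)).
  by ring.
apply: le_lt_trans (ler_normD _ _) _.
have -> : e = e / 3 + (e / 3 + e / 3) by lra.
rewrite rmorphD ltrD //; apply: le_lt_trans (ler_normB _ _) _.
by rewrite rmorphD ltrD // tail.
Qed.

Lemma cvg_expr_complex y : `|y| < 1 ->
  (fun n => y ^+ n : (R[i] : numFieldType)) @ \oo --> (0 : (R[i] : numFieldType)).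
Proof.
move=> /norm_lt1_complexE[t /andP[t0 t1] yt].
apply/cvgrPdist_lt => _ /gt0_complexE[e e0 ->].
have /(@cvg_geometric R 1) : `|t| < 1 by rewrite ger0_norm.
move=> /cvgrPdist_lt /(_ e e0); apply: filterS => n.
rewrite /= !sub0r !normrN mul1r ger0_norm ?exprn_ge0 // normrX yt.
by rewrite -rmorphXn ltcR.
Qed.

Lemma cvg_geometric_sum y : `|y| < 1 ->
  (fun n => \sum_(j < n) y ^+ j : (R[i] : numFieldType)) @ \oo -->
  ((1 - y)^-1 : (R[i] : numFieldType)).
Proof.
move=> y1; have ny : 1 - y != 0.
  by rewrite subr_eq0; apply: contraTneq y1 => <-; rewrite normr1 ltxx.
rewrite -[(1 - y)^-1]mul1r -[X in X / _]subr0.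
have h : (fun n => (1 - y ^+ n) / (1 - y) : (R[i] : numFieldType)) @ \oo -->
   ((1 - 0) / (1 - y) : (R[i] : numFieldType)).
  apply: cvgMr_tmp; apply: cvgB; first exact: cvg_cst.
  exact: cvg_expr_complex.
apply: eq_fun_cvg h => n.
by rewrite -[1 - y ^+ n]opprB subrX1 -mulNr opprB mulrAC divff // mul1r.
Qed.

End ComplexSums.

(** * Overpartitions as multiplicity functions *)

Section Overpartitions.
Local Open Scope nat_scope.
Implicit Types (s : seq (nat * bool)) (p : overpartition).

(** The definition tests an overlined entry against the prefix before it. A new head joins the
    prefix of every later entry, which forbids exactly [(x.1, true)] in the tail. *)
Lemma is_overpartition_cons x s :
  is_overpartition (x :: s) =
  [&& all (geq x.1) (unzip1 s), 0 < x.1, (x.1, true) \notin s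
    & is_overpartition s].
Proof.
have tr : transitive geq by move=> ? ? ? /= h1 h2; exact: leq_trans h2 h1.
rewrite /is_overpartition /= path_sortedE //.
set P := [forall i, _]; set Q := [forall i, _].
have -> : P = ((x.1, true) \notin s) && Q.
  apply/forallP/andP => [h|[h1 /forallP h2] i].
    split.
      apply/negP => xs; have is_ : (index (x.1, true) s).+1 < (size s).+1.
        by rewrite ltnS index_mem.
      by have := h (Ordinal is_); rewrite /= nth_index //= in_cons eqxx.
    apply/forallP => i /=; apply/implyP => hi.
    have is_ : i.+1 < (size s).+1 := ltn_ord i.
    by have := h (Ordinal is_); rewrite /= hi in_cons negb_or => /andP[].
  case: i => [[|i] /= lti]; first by rewrite implybT.
  apply/implyP => hi; rewrite in_cons negb_or.
  have := h2 (Ordinal (lti : i < size s)); rewrite /= hi /= => ->.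
  rewrite andbT; apply/negP => /eqP xE; case/negP: h1.
  rewrite -xE; have := mem_nth (0, false) (lti : i < size s).
  by case: nth hi => ? ? /= ->.
by case: all; case: sorted; case: (0 < _); case: all; case: (_ \notin _).
Qed.

(** Lexicographic order with the overlined copy first. Overpartitions are sorted for it, hence
    determined by their multiplicities. *)
Definition part_ge (x y : nat * bool) : bool :=
  (y.1 < x.1) || (y.1 == x.1) && (y.2 ==> x.2).

Lemma part_ge_trans : transitive part_ge.
Proof. by move=> [? []] [? []] [? []]; rewrite /part_ge /=; lia. Qed.

Lemma part_ge_anti : antisymmetric part_ge.
Proof.
move=> [x b] [y c] h; have [-> ->] // : x = y /\ b = c.
by move: b c h => [] []; rewrite /part_ge /=; split=> //; lia.
Qed.

Lemma overpartition_sorted s : is_overpartition s -> sorted part_ge s.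
Proof.
elim: s => //= x s IH; rewrite is_overpartition_cons.
case/and4P=> /allP hx _ xs /IH hs; rewrite path_sortedE ?hs ?andbT;
  last exact: part_ge_trans.
apply/allP => y ys; have /= := hx y.1 (map_f _ ys).
rewrite /part_ge leq_eqVlt => /orP[/eqP e|->//].
case: y ys e => y [] //= ys e; last by rewrite e eqxx orbT.
by rewrite -e ys in xs.
Qed.

Lemma count_overlined s m : is_overpartition s ->
  count_mem (m, true) s = ((m, true) \in s).
Proof.
elim: s => //= x s IH; rewrite is_overpartition_cons.
case/and4P=> _ _ xs /IH ->; rewrite in_cons.
by rewrite [x == _]eq_sym; case: eqP xs => [<- /= /negPf ->|].
Qed.

Lemma eq_overpartition p1 p2 :
  (forall x, count_mem x (p1 : seq _) = count_mem x (p2 : seq _)) -> p1 = p2.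
Proof.
move=> h; apply: val_inj; apply: (sorted_eq part_ge_trans part_ge_anti).
- exact/overpartition_sorted/(valP p1).
- exact/overpartition_sorted/(valP p2).
- by apply/allP => x _; exact/eqP/h.
Qed.

(* [g i] is the pair of the multiplicity of the non-overlined part [i.+1] and *)
(* of the presence of the overlined one.                                      *)
Fixpoint parts_of (g : nat -> nat * bool) (N : nat) : seq (nat * bool) :=
  if N is n.+1 then
    nseq (g n).2 (n.+1, true) ++ nseq (g n).1 (n.+1, false) ++ parts_of g n
  else [::].

Lemma parts_of_le g N x : x \in parts_of g N -> 0 < x.1 <= N.
Proof.
elim: N => //= N IH; rewrite !mem_cat !mem_nseq.
case/or3P=> [/andP[_ /eqP->]|/andP[_ /eqP->]|/IH] //=; lia.
Qed.

Lemma count_parts_of g N m b :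
  count_mem (m.+1, b) (parts_of g N) =
  if m < N then (if b then (g m).2 : nat else (g m).1) else 0.
Proof.
elim: N => //= N IH; rewrite !count_cat !count_nseq IH /= !xpair_eqE !eqSS.
rewrite {IH} eq_sym ltnS [m <= N]leq_eqVlt.
case: eqP => [->|_]; first by rewrite ltnn; case: b; rewrite /= ?mul1n ?addn0.
by rewrite !mul0n.
Qed.

Lemma overpartition_parts_of g N : is_overpartition (parts_of g N).
Proof.
elim: N => [|N IH] /=; first by apply/and3P; split=> //; apply/forallP => -[].
have ub : all (geq N.+1) (unzip1 (parts_of g N)).
  by rewrite all_map; apply/allP => x /parts_of_le /=; lia.
have nb b : (N.+1, b) \notin parts_of g N.
  by apply/negP => /parts_of_le /=; lia.
set t := nseq (g N).1 _ ++ _.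
have [ht tb tn] : [/\ is_overpartition t, all (geq N.+1) (unzip1 t)
    & (N.+1, true) \notin t].
  rewrite /t; elim: (g N).1 => [|j [h1 h2 h3]] /=; first by split.
  split.
  - by rewrite is_overpartition_cons /= h1 h2 h3.
  - by rewrite leqnn h2.
  - by rewrite in_cons negb_or h3 xpair_eqE andbF.
by case: (g N).2 => //=; rewrite is_overpartition_cons /= ht tb tn.
Qed.

Definition overpartition_of g N := Overpartition (overpartition_parts_of g N).

Lemma weight_overpartition_of g N :
  weight (overpartition_of g N) = \sum_(i < N) i.+1 * ((g i).1 + (g i).2).
Proof.
rewrite /weight /=; elim: N => [|N IH] /=; first by rewrite big_ord0.
rewrite big_ord_recr /= -IH /unzip1 !map_cat !sumn_cat !map_nseq !sumn_nseq /=.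
lia.
Qed.

Definition mult p (i : nat) : nat * bool :=
  (count_mem (i.+1, false) (p : seq _), (i.+1, true) \in (p : seq _)).

Lemma part_gt0 p x : x \in (p : seq _) -> 0 < x.1.
Proof.
by move=> xp; case/and3P: (valP p) => _ /allP h _; apply: h; exact: map_f.
Qed.

Lemma part_le_weight p x : x \in (p : seq _) -> x.1 <= weight p.
Proof.
rewrite /weight; elim: (p : seq _) => //= y s IH; rewrite in_cons.
by case/predU1P=> [->|/IH]; lia.
Qed.

(** No part exceeds the weight, so cutting the sizes at [N] loses nothing. *)
Lemma overpartition_ofK p N : weight p <= N -> overpartition_of (mult p) N = p.
Proof.
move=> pN; apply: eq_overpartition => -[[|m] b] /=.
  rewrite !(count_memPn _) //; apply/negP; first by move/part_gt0.
  by move/parts_of_le.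
rewrite count_parts_of; case: ltnP => [_|Nm].
  by case: b => //=; rewrite count_overlined // (valP p).
by rewrite (count_memPn _) //; apply/negP => /part_le_weight /=; lia.
Qed.

Lemma mult_overpartition_of g N i : i < N -> mult (overpartition_of g N) i = g i.
Proof.
move=> iN; rewrite /mult /= count_parts_of iN -has_pred1 has_count.
by rewrite count_parts_of iN; case: (g i) => ? [].
Qed.


Lemma count_le_weight p m b : count_mem (m.+1, b) (p : seq _) <= weight p.
Proof.
rewrite /weight; elim: (p : seq _) => //= y s IH.
by apply: leq_add => //; case: eqP => // ->.
Qed.

(** * Finite boxes of overpartitions and their generating functions *)

Definition extend N M (f : {ffun 'I_N -> 'I_M.+1 * bool}) (i : nat) :
    nat * bool :=
  if insub i is Some j then (val (f j).1, (f j).2) else (0, false).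

Lemma extendE N M (f : {ffun 'I_N -> 'I_M.+1 * bool}) (i : 'I_N) :
  extend f i = (val (f i).1, (f i).2).
Proof. by rewrite /extend valK. Qed.

(** Sizes are at most [N], with at most [M] non-overlined copies of each and a free overlined
    copy. *)
Definition box N M : {fset overpartition} :=
  [fset overpartition_of (extend f) N | f in {ffun 'I_N -> 'I_M.+1 * bool}]%fset.

Lemma overpartition_of_extend_inj N M :
  injective (fun f : {ffun 'I_N -> 'I_M.+1 * bool} =>
    overpartition_of (extend f) N).
Proof.
move=> f1 f2 /= e; apply/ffunP => i.
have := congr1 (mult^~ i) e; rewrite !mult_overpartition_of // !extendE.
by case: (f1 i) (f2 i) => [? ?] [? ?] [/val_inj -> ->].
Qed.

Lemma big_box (V : nmodType) N M (F : overpartition -> V) :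
  (\sum_(p <- box N M) F p =
   \sum_(f : {ffun 'I_N -> 'I_M.+1 * bool}) F (overpartition_of (extend f) N))%R.
Proof.
rewrite big_imfset /=; last by move=> f1 f2 _ _; exact: overpartition_of_extend_inj.
by rewrite big_enum_cond.
Qed.

Lemma mem_box p N M : weight p <= N -> weight p <= M -> p \in box N M.
Proof.
move=> pN pM; apply/imfsetP => /=.
(* [inord] keeps the value here: a multiplicity is at most [weight p], hence at most [M]. *)
exists [ffun i : 'I_N => (inord (mult p i).1, (mult p i).2)] => //.
rewrite -[LHS](overpartition_ofK pN); apply: eq_overpartition => -[[|m] b].
  by rewrite !(count_memPn _) //; apply/negP => /parts_of_le.
rewrite /= !count_parts_of; case: ltnP => // mN.
rewrite -[m]/(val (Ordinal mN)) extendE ffunE /= inordK //.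
exact: leq_ltn_trans (count_le_weight _ _ _) _.
Qed.

Definition full_at r m p :=
  ((m, true) \in (p : seq _)) && (r - 1 <= count_mem (m, false) (p : seq _)).

Lemma full_at_overpartition_of r g N (i : 'I_N) :
  full_at r i.+1 (overpartition_of g N) = (g i).2 && (r - 1 <= (g i).1).
Proof.
by rewrite -(mult_overpartition_of g (ltn_ord i)).
Qed.

(** Choosing multiplicities size by size turns the sum into a product. For a size in [D] the
    overlined part is forced, hence the exponent [j.+1] with [r - 1 <= j]; elsewhere the free flag
    gives [1 + q ^+ i.+1]. *)
Lemma gf_box (K : comNzRingType) (q : K) r (D : seq nat) N M :
  all (fun m => 0 < m <= N) D ->
  (\sum_(p <- box N M) (all (full_at r ^~ p) D)%:R * q ^+ weight p =
   \prod_(i < N)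
     if i.+1 \in D
     then \sum_(j < M.+1 | (r - 1 <= j)%N) (q ^+ i.+1) ^+ j.+1
     else (1 + q ^+ i.+1) * \sum_(j < M.+1) (q ^+ i.+1) ^+ j)%R.
Proof.
move=> /allP D_N; rewrite big_box; set rhs := RHS.
pose h (i : 'I_N) (x : 'I_M.+1 * bool) : K :=
  (((i.+1 \in D) ==> x.2 && (r - 1 <= x.1)%N)%:R
   * q ^+ (i.+1 * (x.1 + x.2)))%R.
transitivity (\sum_(f : {ffun 'I_N -> 'I_M.+1 * bool}) \prod_i h i (f i))%R.
  apply: eq_bigr => f _; rewrite big_split /=; congr (_ * _)%R.
    case: (boolP (all _ _)) => [/allP h1|/allPn[m mD nh]].
      rewrite big1 // => i _; case: (boolP (_ \in D)) => //= iD.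
      by have := h1 _ iD; rewrite full_at_overpartition_of extendE /= => ->.
    (* A size [m] in [D] that is not full kills the product through its factor, which has index
       [m.-1]. *)
    have /andP[m0 mN] := D_N _ mD.
    have mN' : m.-1 < N by rewrite prednK.
    rewrite (bigD1 (Ordinal mN')) //= prednK // mD /=.
    move: nh; rewrite -{1}(prednK m0) -[m.-1]/(val (Ordinal mN')).
    by rewrite full_at_overpartition_of extendE /= => /negPf ->; rewrite mul0r.
  rewrite weight_overpartition_of expr_sum; apply: eq_bigr => i _.
  by rewrite extendE.
rewrite -bigA_distr_bigA; apply: eq_bigr => i _.
rewrite -(pair_bigA _ (fun j b => h i (j, b))) /=.
under eq_bigr do rewrite big_bool /h /= addn1 addn0 !exprM.
case: ifP => _ /=.
  rewrite [RHS]big_mkcond /=; apply: eq_bigr => j _.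
  by case: ifP => _; rewrite ?mul1r !mul0r addr0.
rewrite big_distrr /=; apply: eq_bigr => j _.
by rewrite !mul1r mulrDl mul1r exprS addrC.
Qed.

(** * The statistic along the progression [a], [A + a], [2A + a], .. *)

Section Mes.
Variables (r A a : nat) (A_gt0 : 0 < A) (a_gt0 : 0 < a) (a_leA : a <= A).

(** A positive [m] congruent to [a] modulo [A] is not below [a], because [a <= A]. When [a = A] the
    residue is 0, which excludes [0 < m < A]. *)
Lemma mesE p : exists k, mes r a A_gt0 p = k * A + a.
Proof.
rewrite /mes; case: ex_minnP => m /and3P[m0 /eqP mA _] _.
have am : a <= m.
  rewrite leqNgt; apply/negP => ma; move: mA; rewrite modn_small; last lia.
  move: a_leA; rewrite leq_eqVlt => /orP[/eqP aA|/modn_small ->]; last lia.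
  by rewrite {1}aA modnn; lia.
exists ((m - a) %/ A); rewrite divnK ?subnK //.
by rewrite -eqn_mod_dvd //; apply/eqP.
Qed.

Lemma mes_cond_progression p j :
  mes_cond r A a p (j * A + a) = ~~ full_at r (j * A + a) p.
Proof.
rewrite /mes_cond /full_at modnMDl eqxx addn_gt0 a_gt0 orbT /=.
by rewrite negb_and -ltnNge.
Qed.

Definition progression k := mkseq (fun j => j * A + a) k.

Lemma progressionS k : progression k.+1 = rcons (progression k) (k * A + a).
Proof. by rewrite /progression mkseqS. Qed.

(** By minimality every term before the statistic is full and the statistic itself is not; this pins
    down [k]. *)
Lemma mes_eq k p :
  (mes r a A_gt0 p == k * A + a) =
  all (full_at r ^~ p) (progression k) &&
  ~~ all (full_at r ^~ p) (progression k.+1).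
Proof.
have [k' ek'] := mesE p; rewrite ek' progressionS all_rcons eqn_add2r.
move: ek'; rewrite /mes; case: ex_minnP => m cm mmin em; subst m.
rewrite eqn_pmul2r //; rewrite mes_cond_progression in cm.
have hk j : j < k' -> full_at r (j * A + a) p.
  move=> jk; apply/negPn/negP; rewrite -mes_cond_progression => /mmin.
  by rewrite leq_add2r leq_pmul2r // leqNgt jk.
apply/eqP/idP => [<-|/andP[/allP hall]].
  rewrite (negPf cm) andbT; apply/allP => _ /mapP[j + ->].
  by rewrite mem_iota => /andP[_ /hk].
rewrite negb_and => /orP[nk|/allPn[x /hall ->] //].
case: (ltngtP k' k) => // [lt|/hk]; last by rewrite (negPf nk).
have : k' * A + a \in progression k.
  by apply/mapP; exists k'; rewrite // mem_iota.
by move=> /hall; rewrite (negPf cm).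
Qed.

End Mes.

Lemma full_progressionS r A a k p :
  all (full_at r ^~ p) (progression A a k.+1) ->
  all (full_at r ^~ p) (progression A a k).
Proof. by rewrite progressionS all_rcons => /andP[]. Qed.

(** Origin of the exponents in the theorem: each forced size [m] contributes [q ^+ (r * m)]. *)
Lemma sum_progression A a k : \sum_(m <- progression A a k) m = A * 'C(k, 2) + k * a.
Proof.
elim: k => [|k IH]; first by rewrite big_nil bin0n muln0.
rewrite progressionS -cats1 big_cat big_seq1 /= IH binS bin1; lia.
Qed.

End Overpartitions.

(** * Generating functions *)

Section OverpartitionSums.
Variable R : realType.
Implicit Types (x y q : R[i]).

Lemma cvg_geometric_tail y r : `|y| < 1 -> (0 < r)%N ->
  (fun M => \sum_(j < M.+1 | (r - 1 <= j)%N) y ^+ j.+1 : (R[i] : numFieldType))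
    @ \oo --> (y ^+ r / (1 - y) : (R[i] : numFieldType)).
Proof.
(* With [r = s.+1] and [M = n + s], exactly [n.+1] indices survive the condition, and [y ^+ s.+1]
   factors out. *)
case: r => // s y1 _; rewrite -(cvg_shiftn s) subn1 /=.
have h : (fun n => y ^+ s.+1 * \sum_(j < n.+1) y ^+ j : (R[i] : numFieldType))
    @ \oo --> (y ^+ s.+1 / (1 - y) : (R[i] : numFieldType)).
  apply: cvgMl_tmp; move: (cvg_geometric_sum y1).
  by rewrite -cvg_shiftS.
apply: eq_fun_cvg h => n.
rewrite (_ : (n + s).+1 = (s + n.+1)%N); last by rewrite addnS addnC.
rewrite [RHS]big_split_ord /= [X in _ = X + _]big_pred0; last first.
  by move=> i /=; rewrite leqNgt ltn_ord.
rewrite add0r big_distrr /= [RHS]big_mkcond /=; apply: eq_bigr => j _.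
by rewrite leq_addr -exprD addSn.
Qed.

(** This supplies absolute convergence. A finite family lies in a box, whose sum factors by [gf_box]
    with empty [D]; the numerators and the geometric sums are each bounded by an exponential. *)
Lemma sum_weight_bounded (t : R) : 0 <= t < 1 ->
  exists B : R, forall S : {fset overpartition},
    \sum_(p <- S) t ^+ weight p <= B.
Proof.
move=> t01; have [t0 t1] := andP t01.
have t1' : 0 < 1 - t by rewrite subr_gt0.
have c0 : 0 <= t / (1 - t) by rewrite divr_ge0 // ltW.
exists (expR (t / (1 - t)) * expR (t / (1 - t) / (1 - t))) => S.
pose N := (\sum_(p <- S) weight p)%N.
have SN : (S `<=` box N N)%fset.
  apply/fsubsetP => p pS; have pN : (weight p <= N)%N.
    by rewrite /N (big_fsetD1 p) //= leq_addr.
  exact: mem_box.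
apply: (@le_trans _ _ (\sum_(p <- box N N) t ^+ weight p)).
  rewrite -subr_ge0 sum_fset_sub // sumr_ge0 // => p _.
  exact: exprn_ge0.
have := @gf_box R t 2 [::] N N isT; under eq_bigr do rewrite mul1r.
move=> ->; rewrite -(big_mkord xpredT (fun i => (1 + t ^+ i.+1) *
  \sum_(j < N.+1) (t ^+ i.+1) ^+ j)).
rewrite big_split /=; apply: ler_pM.
- by apply: prodr_ge0 => i _; rewrite addr_ge0 ?exprn_ge0.
- by apply: prodr_ge0 => i _; apply: sumr_ge0 => j _; rewrite !exprn_ge0.
- under eq_bigr do rewrite exprS.
  exact: prod_geometric_le.
- apply: le_trans (prod_geometric_le N c0 t01); apply: ler_prod => i _.
  rewrite sumr_ge0 /=; last by move=> j _; rewrite !exprn_ge0.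
  have y01 : 0 <= t ^+ i.+1 < 1 by rewrite exprn_ge0 // exprn_ilt1.
  rewrite -(big_mkord xpredT (fun j => (t ^+ i.+1) ^+ j)).
  apply: le_trans (geometric_sum_le _ y01) _.
  case/andP: y01 => y0 y1; have y1' : 0 < 1 - t ^+ i.+1 by rewrite subr_gt0.
  (* The factor is brought below [1 + c * t ^+ i] with [c = t / (1 - t)], using [t ^+ i.+1 <= t] in
     the denominator. *)
  have -> : (1 - t ^+ i.+1)^-1 = 1 + t ^+ i.+1 / (1 - t ^+ i.+1).
    by rewrite -{1}[1](subrK (t ^+ i.+1)) [X in _ = X]addrC;
       field; rewrite gt_eqF.
  rewrite lerD2l mulrAC -exprS ler_wpM2l // lef_pV2 ?posrE //.
  by rewrite lerD2l lerN2 exprS ler_piMr // exprn_ile1 // ltW.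
Qed.

(** * q-Pochhammer symbols and the product for all overpartitions *)

Lemma cvg_qpoch_inf x q : `|q| < 1 ->
  (fun n => \prod_(i < n) (1 - x * q ^+ i) : (R[i] : numFieldType)) @ \oo -->
  (qpoch_inf x q : (R[i] : numFieldType)).
Proof.
move=> q1; have h := is_cvg_qpoch_inf (x := x) q1.
by apply: eq_fun_cvg h => n; rewrite big_mkord.
Qed.

(** Splitting the first [k] factors off the infinite product survives the limit, and the remaining
    infinite product is nonzero, so it may be divided out. *)
Lemma qpochE x q k : `|x| < 1 -> `|q| < 1 ->
  qpoch x q k = \prod_(j < k) (1 - x * q ^+ j).
Proof.
move=> x1 q1.
have xq1 : `|x * q ^+ k| < 1.
  rewrite normrM normrX; apply: le_lt_trans x1.
  by rewrite ler_piMr // exprn_ile1 // ltW.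
rewrite /qpoch; apply: (mulIf (qpoch_inf_neq0 xq1 q1)).
rewrite divfK ?qpoch_inf_neq0 //.
have h1 : (fun n => \prod_(j < k) (1 - x * q ^+ j) *
    \prod_(i < n) (1 - x * q ^+ k * q ^+ i) : (R[i] : numFieldType)) @ \oo -->
    (\prod_(j < k) (1 - x * q ^+ j) * qpoch_inf (x * q ^+ k) q
       : (R[i] : numFieldType)).
  by apply: cvgMl_tmp; exact: cvg_qpoch_inf.
have h2 := cvg_qpoch_inf (x := x) q1.
rewrite -(cvg_shiftn k) in h2.
apply: (cvg_unique (@norm_hausdorff _ _) h2).
apply: eq_fun_cvg h1 => n /=; rewrite addnC big_split_ord /=.
by congr (_ * _); apply: eq_bigr => i _; rewrite exprD mulrA.
Qed.

Lemma cvg_overpartition_product q : `|q| < 1 ->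
  (fun n => \prod_(i < n) ((1 + q ^+ i.+1) / (1 - q ^+ i.+1))
     : (R[i] : numFieldType)) @ \oo -->
  (qpoch_inf (- q) q / qpoch_inf q q : (R[i] : numFieldType)).
Proof.
move=> q1.
have h : (fun n => \prod_(i < n) (1 - (- q) * q ^+ i) *
    (\prod_(i < n) (1 - q * q ^+ i))^-1 : (R[i] : numFieldType)) @ \oo -->
    (qpoch_inf (- q) q / qpoch_inf q q : (R[i] : numFieldType)).
  apply: cvgM; first exact: cvg_qpoch_inf.
  by apply: cvgV; [exact: qpoch_inf_neq0|exact: cvg_qpoch_inf].
apply: eq_fun_cvg h => n; rewrite -prodfV -big_split /=.
by apply: eq_bigr => i _; rewrite mulNr opprK exprS.
Qed.

Lemma prod_shift_mem (K : comNzRingType) (F : nat -> K) (D : seq nat) N :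
  uniq D -> all (fun m => 0 < m <= N)%N D ->
  \prod_(i < N) (if i.+1 \in D then F i.+1 else 1) = \prod_(m <- D) F m.
Proof.
move=> uD /allP D_N.
rewrite -(big_mkord xpredT (fun i => if i.+1 \in D then F i.+1 else 1)).
rewrite -(big_add1 _ _ 0 N.+1 xpredT (fun m => if m \in D then F m else 1)).
rewrite -big_mkcond -big_filter; apply: perm_big; apply: uniq_perm => //.
  by rewrite filter_uniq // iota_uniq.
move=> m; rewrite mem_filter mem_index_iota andb_idr // => /D_N.
by rewrite ltnS.
Qed.

Lemma cvg_full_sum q r (D : seq nat) :
  `|q| < 1 -> (0 < r)%N -> uniq D -> all (leq 1) D ->
  summability.partial_sum (fun p : overpartition =>
      (all (full_at r ^~ p) D)%:R * q ^+ weight p : (R[i] : numFieldType))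
    @ summability.totally -->
  (qpoch_inf (- q) q / qpoch_inf q q *
    \prod_(m <- D) (q ^+ (r * m) / (1 + q ^+ m)) : (R[i] : numFieldType)).
Proof.
move=> q1 r0 uD /allP D0; set L := _ * _.
have [t t01 qt] := norm_lt1_complexE q1.
have [B hB] := sum_weight_bounded t01.
apply: (@cvg_totally_cluster R _ _ (fun p => t ^+ weight p) B) => //.
  move=> p; rewrite normrM normrX qt -rmorphXn ler_piMl //.
    by rewrite (lecR 0) exprn_ge0 //; case/andP: t01.
  by case: all; rewrite ?normr1 ?normr0 ?ler01.
move=> S e e0; have e20 : 0 < e / 2 by rewrite divr_gt0.
(* [N0] bounds every size in [D] and every weight in [S], so from [N0] on the boxes contain [S] and
   [gf_box] applies. *)
pose N0 := (\sum_(m <- D) m + \sum_(p <- S) weight p)%N.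
have DN N : (N0 <= N)%N -> all (fun m => 0 < m <= N)%N D.
  move=> NN; apply/allP => m mD; rewrite D0 //=; apply: leq_trans NN.
  by rewrite /N0 (big_rem m) //= -addnA leq_addr.
have Sbox N M : (N0 <= N)%N -> (N0 <= M)%N -> (S `<=` box N M)%fset.
  move=> NN NM; apply/fsubsetP => p pS; have pN : (weight p <= N0)%N.
    by rewrite /N0 (big_fsetD1 p) //= addnCA leq_addr.
  by apply: mem_box; apply: leq_trans pN _.
pose F m : R[i] := q ^+ (r * m) / (1 + q ^+ m).
pose G N : R[i] := \prod_(i < N) ((1 + q ^+ i.+1) / (1 - q ^+ i.+1) *
  (if i.+1 \in D then F i.+1 else 1)).
have qi1 i : `|q ^+ i.+1| < 1 by rewrite normrX exprn_ilt1.
have nz i : 1 + q ^+ i.+1 != 0.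
  by rewrite addrC addr_eq0; apply: contraTneq (qi1 i) => ->;
    rewrite normrN1 ltxx.
have GL : (G : nat -> (R[i] : numFieldType)) @ \oo --> (L : (R[i] : numFieldType)).
  (* From [N0] on, all of [D] lies in range, so the correcting factors multiply to a constant. *)
  rewrite -(cvg_shiftn N0).
  have h : (fun n => \prod_(i < n + N0) ((1 + q ^+ i.+1) / (1 - q ^+ i.+1)) *
      \prod_(m <- D) F m : (R[i] : numFieldType)) @ \oo -->
      (L : (R[i] : numFieldType)).
    apply: cvgMr_tmp; have := cvg_overpartition_product q1.
    by rewrite -(cvg_shiftn N0).
  apply: eq_fun_cvg h => n; rewrite /G [RHS]big_split; congr (_ * _).
  rewrite [RHS](prod_shift_mem F) //.
  by apply: DN; rewrite leq_addl.
have boxG N : (N0 <= N)%N ->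
    (fun M => \sum_(p <- box N M) (all (full_at r ^~ p) D)%:R * q ^+ weight p
       : (R[i] : numFieldType)) @ \oo --> (G N : (R[i] : numFieldType)).
  move=> NN.
  have h : (fun M => \prod_(i < N)
     (if i.+1 \in D
     then \sum_(j < M.+1 | (r - 1 <= j)%N) (q ^+ i.+1) ^+ j.+1
     else (1 + q ^+ i.+1) * \sum_(j < M.+1) (q ^+ i.+1) ^+ j)
       : (R[i] : numFieldType)) @ \oo --> (G N : (R[i] : numFieldType)).
    apply: cvg_big => [|i _]; first exact: mul_continuous.
    case: ifP => _.
      (* The numerator of the unrestricted factor cancels the denominator of [F]. *)
      have -> : (1 + q ^+ i.+1) / (1 - q ^+ i.+1) * F i.+1 =
          (q ^+ i.+1) ^+ r / (1 - q ^+ i.+1).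
        rewrite /F mulnC exprM mulrAC mulrCA !mulrA.
        by rewrite mulfK // mulrC mulrA.
      exact: cvg_geometric_tail.
    rewrite mulr1; apply: cvgMl_tmp.
    by have := cvg_geometric_sum (qi1 i); rewrite -cvg_shiftS.
  by apply: eq_fun_cvg h => M; rewrite gf_box // DN.
have e2C : 0 < (e / 2)%:C by rewrite (ltcR 0).
move: GL => /cvgrPdist_lt/(_ _ e2C) GL.
(* [N] is fixed first, as the threshold for [M] depends on it; each choice costs [e / 2]. *)
have [N [LN NN]] := filter_ex (filterI GL (nbhs_infty_ge N0)).
move: (boxG N NN) => /cvgrPdist_lt/(_ _ e2C) {}boxG.
have [M [GM NM]] := filter_ex (filterI boxG (nbhs_infty_ge N0)).
exists (box N M); first exact: Sbox.
rewrite [e]splitr rmorphD; apply: le_lt_trans (ler_distD (G N) _ _) _.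
exact: ltrD.
Qed.

End OverpartitionSums.

(** * Comparison of the coefficients of powers of [z] *)

Lemma cvg_series_single (K : numFieldType) (c : K) (k : nat) :
  series (fun i => if i == k then c else 0) @ \oo --> c.
Proof.
rewrite -(cvg_shiftn k.+1).
have h : (fun=> c) @ \oo --> c by exact: cvg_cst.
apply: eq_fun_cvg h => n /=; rewrite /series /= -big_mkcond /=.
by rewrite big_nat1_eq /=; case: ifP => //; rewrite addnS ltnS leq_addl.
Qed.

Lemma prod_progression (R : realType) (q : R[i]) r A a k :
  `|q| < 1 -> (0 < a)%N -> (0 < A)%N ->
  \prod_(m <- progression A a k) (q ^+ (r * m) / (1 + q ^+ m)) =
  q ^+ (r * (A * 'C(k, 2) + k * a)) / qpoch (- q ^+ a) (q ^+ A) k.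
Proof.
move=> q1 a0 A0; rewrite big_split /= prodfV.
rewrite -sum_progression big_distrr /= -expr_sum; congr (_ / _).
rewrite qpochE ?normrN ?normrX ?exprn_ilt1 // -?lt0n //.
rewrite big_map -(big_mkord xpredT (fun j => 1 - - q ^+ a * (q ^+ A) ^+ j)).
rewrite /index_iota subn0; apply: eq_bigr => j _.
by rewrite mulNr opprK -exprM -exprD mulnC addnC.
Qed.

Theorem theorem2p5 (R : realType) (A a r : nat)
    (a_ge1 : (1 <= a)%N) (a_leA : (a <= A)%N) (r_ge2 : (2 <= r)%N)
    (q : R[i]) (q_lt1 : `|q| < 1) :
  let lhs_term (p : overpartition) :=
    fps_mono (q ^+ weight p) (mes r a (leq_trans a_ge1 a_leA) p) in
  let rhs_term (k : nat) :=
    fps_mono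
      (q ^+ (r * (A * 'C(k, 2) + k * a)) / qpoch (- q ^+ a) (q ^+ A) k
       - q ^+ (r * (A * 'C(k.+1, 2) + k.+1 * a))
         / qpoch (- q ^+ a) (q ^+ A) k.+1)
      (k * A + a)%N in
  [/\ fps_summable lhs_term,
      fps_cvg_series rhs_term &
      fps_sum lhs_term =
      fps_scale (qpoch_inf (- q) q / qpoch_inf q q) (fps_series rhs_term)].
Proof.
set A_gt0 := leq_trans _ _ => lhs_term rhs_term.
pose K : numFieldType := R[i].
pose C : K := qpoch_inf (- q) q / qpoch_inf q q.
pose c k : K := q ^+ (r * (A * 'C(k, 2) + k * a)) / qpoch (- q ^+ a) (q ^+ A) k.
have totF : ProperFilter (@summability.totally overpartition).
  exact: summability.totally_filter.
have r0 : (0 < r)%N by exact: leq_trans r_ge2.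
(* [f k] keeps the overpartitions whose statistic is at least [k * A + a]. *)
pose f k (p : overpartition) : K :=
  (all (full_at r ^~ p) (progression A a k))%:R * q ^+ weight p.
have cvgf k : summability.partial_sum (f k) @ summability.totally --> C * c k.
  rewrite /C /c -prod_progression //; apply: cvg_full_sum => //.
    rewrite map_inj_uniq ?iota_uniq // => i j /addIn /eqP.
    by rewrite eqn_pmul2r // => /eqP.
  by apply/allP => _ /mapP[j _ ->]; rewrite addn_gt0 a_ge1 orbT.
(* All three claims are coefficientwise and follow from one limit [l], multiplied by [C] on the
   left-hand side. *)
suff main m : exists2 l : K,
    summability.partial_sum (fun p => lhs_term p m : K)
      @ summability.totally --> C * l &
    series (fun k => rhs_term k m : K) @ \oo --> l.
  split=> [m|m|].
  - by have [l h _] := main m; apply/cvg_ex; exists (C * l).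
  - by have [l _ h] := main m; apply/cvg_ex; exists l.
  - apply/funext => m; have [l h1 h2] := main m.
    rewrite /fps_sum /fps_scale /fps_series.
    by rewrite (cvg_lim (@norm_hausdorff _ _) h1) (cvg_lim (@norm_hausdorff _ _) h2).
have [[k ->]|nk] := pselect (exists k, m = (k * A + a)%N).
  exists (c k - c k.+1).
    have h : (fun S => summability.partial_sum (f k) S -
        summability.partial_sum (f k.+1) S) @ summability.totally -->
        C * (c k - c k.+1) by rewrite mulrBr; apply: cvgB; exact: cvgf.
    apply: eq_fun_cvg h => S; rewrite -sumrB; apply: eq_bigr => i _.
    rewrite /lhs_term /fps_mono eq_sym mes_eq // /f -mulrBl.
    (* The conditions are nested in [k], so the difference of the two indicators is the indicator of
       the statistic being [k * A + a]. *)
    have := @full_progressionS r A a k (val i).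
    case: (all _ (progression A a k.+1)) => [/(_ isT) ->|_];
      last case: (all _ (progression A a k)).
    + by rewrite subrr mul0r.
    + by rewrite subr0 mul1r.
    + by rewrite subrr mul0r.
  (* As [0 < A], the exponents are distinct, so a single index contributes. *)
  have h := @cvg_series_single K (c k - c k.+1) k.
  apply: eq_fun_cvg h => n.
  apply: eq_bigr => i _; rewrite /rhs_term /fps_mono eqn_add2r eqn_pmul2r // eq_sym.
  by case: eqP => [->|].
(* Off the progression every term on either side has coefficient 0. *)
exists 0.
  have h : (fun=> 0 : K) @ (@summability.totally overpartition) --> C * 0.
    by rewrite mulr0; exact: cvg_cst.
  apply: eq_fun_cvg h => S; rewrite [RHS]big1 // => p _.
  rewrite /lhs_term /fps_mono; case: eqP => // e.
  by have [k ek] := mesE r A_gt0 a_ge1 a_leA (val p); case: nk; exists k; rewrite e.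
have h : (fun=> 0 : K) @ \oo --> (0 : K) by exact: cvg_cst.
apply: eq_fun_cvg h => n; rewrite [RHS]big1 // => k _.
by rewrite /rhs_term /fps_mono; case: eqP => // e; case: nk; exists k.
Qed.
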